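(* Let $\mathbf{Z}$ be a generalized slit carpet and let $X$ be a Banach space with the RNP property. Then there is no bi-Lipschitz embedding of $\mathbf{Z}$ into $X$. In particular, $\mathbf{Z}$ does not admit a bi-Lipschitz embedding into any Euclidean space.
   Context: A map $f:(X,d_X)\to(Y,d_Y)$ is a bi-Lipschitz embedding if there are constants $0<c\le C$ with $c\,d_X(x,y)\le d_Y(f(x),f(y))\le C\,d_X(x,y)$ for all $x,y\in X$. A Banach space $X$ has the RNP property if every Lipschitz map $\gamma:[0,1]\to X$ is differentiable almost everywhere. A slit is a set $S=\{x_S\}\times(a_S,b_S)\subset[0,1]^2$ with $0<a_S<b_S<1$; put $\ell(S)=b_S-a_S$. Let $\mathcal{S}$ be a countable collection of non-overlapping (pairwise disjoint) slits in $[0,1]^2$, let $Z=[0,1]^2\setminus\bigcup_{S\in\mathcal{S}}S$ with the path metric $d_Z$ (infimum of Euclidean lengths of paths in $Z$), and let $\mathbf{Z}$ be the metric completion of $(Z,d_Z)$. $\mathbf{Z}$ is called a generalized (general vertical) slit carpet if there exist constants $C_0,\delta>0$ such that: (1) (slits at every scale and location) for every $z\in[0,1]^2$ and every $r\in(0,1)$ there is a slit $S\in\mathcal{S}$ with $S\subset B(z,r)$ (Euclidean ball) and $\delta r\le\ell(S)\le C_0r$; (2) (slits decay in size) for every $\epsilon>0$ the set $\{S\in\mathcal{S}:\ell(S)>\epsilon\}$ is finite; (3) (horizontal corridor, or $h$-condition) there is $\eta\in(0,1)$ such that for every $S\in\mathcal{S}$ the segments $[x_S-\eta\ell(S),x_S+\eta\ell(S)]\times\{a_S\}$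 and $[x_S-\eta\ell(S),x_S+\eta\ell(S)]\times\{b_S\}$ are contained in $Z$. These conditions ensure that $d_Z$ is finite, so that $\mathbf{Z}$ is a metric space. *)

(* Defs.v *)
From HB Require Import structures.
From mathcomp Require Export all_boot all_order all_algebra.
From mathcomp Require Export all_classical all_reals all_analysis.
Export Order.TTheory GRing.Theory Num.Theory.
Export numFieldNormedType.Exports.

Set Implicit Arguments.
Unset Strict Implicit.
Unset Printing Implicit Defensive.

Local Open Scope classical_set_scope.
Local Open Scope ring_scope.

#[short(type="completeMetricType")]
HB.structure Definition CompleteMetric (K : numDomainType) :=
  {M of Complete M & Metric K M}.

Definition bilipschitz_embedding (R : realType) (T U : Type)
    (dT : T -> T -> R) (dU : U -> U -> R) (f : T -> U) : Prop :=
  exists c C : R, [/\ 0 < c, c <= C &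
    forall x y, c * dT x y <= dU (f x) (f y) <= C * dT x y].

Definition norm_dist (R : realType) (X : normedModType R) (x y : X) : R :=
  `|x - y|.

(* The norm of 'rV[R]_n is the sup norm; Euclidean space needs its own
   distance. *)
Definition euclidean_dist (R : realType) (n : nat) (u v : 'rV[R]_n) : R :=
  Num.sqrt (\sum_(i < n) (u ord0 i - v ord0 i) ^+ 2).

(* Only the values of gamma on [0,1] matter: derivability at an interior point
   is local, and the two endpoints form a null set. *)
Definition RNP (R : realType) (X : completeNormedModType R) : Prop :=
  forall gamma : R -> X,
    [lipschitz gamma t | t in `[0, 1]] ->
    {ae (@lebesgue_measure R), forall t, t \in `]0, 1[ -> derivable gamma t 1}.

(* The norm of the product R * R is the sup norm as well. *)
Definition plane_dist (R : realType) (p q : R * R) : R :=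
  Num.sqrt ((p.1 - q.1) ^+ 2 + (p.2 - q.2) ^+ 2).

Definition plane_ball (R : realType) (z : R * R) (r : R) : set (R * R) :=
  [set q | plane_dist z q < r].

Definition unit_square (R : realType) : set (R * R) := `[0, 1] `*` `[0, 1].

(* Length on [0,1]. [itv_partition 0 1 s] says that 0 :: s increases strictly
   from 0 to 1, and the sum is the length of the polygonal line through the
   points gamma t for t in 0 :: s. *)
Definition curve_length (R : realType) (gamma : R -> R * R) : \bar R :=
  ereal_sup [set (\sum_(i < size s)
      plane_dist (gamma (nth 0 (0 :: s) i)) (gamma (nth 0 s i)))%:E
    | s in itv_partition 0 1].

(* The value is +oo when no rectifiable path in Z joins p to q. *)
Definition path_dist (R : realType) (Z : set (R * R)) (p q : R * R) : \bar R :=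
  ereal_inf [set curve_length gamma | gamma in
    [set gamma : R -> R * R | [/\ {within `[0, 1], continuous gamma},
      gamma 0 = p, gamma 1 = q & gamma @` `[0, 1] `<=` Z]]].

(* The metric completion of (Z, d), up to isometry. Finiteness of d on Z is
   implied, and iota is unconstrained outside Z. *)
Definition is_metric_completion (R : realType) (T : Type) (Z : set T)
    (d : T -> T -> \bar R) (M : completeMetricType R) (iota : T -> M) : Prop :=
  (forall p q, Z p -> Z q -> (mdist (iota p) (iota q))%:E = d p q) /\
  dense (iota @` Z).

Record slit (R : realType) := Slit {
  slit_x : R;
  slit_a : R;
  slit_b : R;
  slit_x_in : 0 <= slit_x <= 1;
  slit_a_gt0 : 0 < slit_a;
  slit_a_lt_b : slit_a < slit_b;
  slit_b_lt1 : slit_b < 1 }.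

Definition slit_set (R : realType) (S : slit R) : set (R * R) :=
  [set slit_x S] `*` `]slit_a S, slit_b S[.

Definition slit_length (R : realType) (S : slit R) : R := slit_b S - slit_a S.

Definition slit_domain (R : realType) (SS : set (slit R)) : set (R * R) :=
  @unit_square R `\` \bigcup_(S in SS) slit_set S.

Definition slits_at_every_scale (R : realType) (SS : set (slit R)) : Prop :=
  exists C0 delta : R, [/\ 0 < C0, 0 < delta &
    forall (z : R * R) (r : R), unit_square z -> 0 < r < 1 ->
      exists S : slit R, [/\ SS S, slit_set S `<=` plane_ball z r &
        delta * r <= slit_length S <= C0 * r]].

Definition slits_decay (R : realType) (SS : set (slit R)) : Prop :=
  forall eps : R, 0 < eps ->
    finite_set [set S | SS S /\ eps < slit_length S].

Definition horizontal_corridors (R : realType) (SS : set (slit R)) : Prop :=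
  exists eta : R, 0 < eta < 1 /\ forall S : slit R, SS S ->
    let I := `[slit_x S - eta * slit_length S,
               slit_x S + eta * slit_length S] in
    [set` I] `*` [set slit_a S] `<=` slit_domain SS /\
    [set` I] `*` [set slit_b S] `<=` slit_domain SS.

Definition generalized_slit_collection (R : realType) (SS : set (slit R)) :
    Prop :=
  [/\ countable SS, trivIset SS (@slit_set R), slits_at_every_scale SS,
      slits_decay SS & horizontal_corridors SS].

Definition generalized_slit_carpet (R : realType) (M : completeMetricType R) :
    Prop :=
  exists SS : set (slit R), generalized_slit_collection SS /\
    exists iota : R * R -> M,
      is_metric_completion (slit_domain SS) (path_dist (slit_domain SS)) iota.

(* Main.v *)
From HB Require Import structures.
Require Import Defs.
From mathcomp Require Import ring lra.

(** Let F be a bi-Lipschitz map on the carpet.  On a vertical line x = t that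
    contains no slit, F is Lipschitz in the second coordinate.  Let S be a slit
    with endpoints at heights a, b and midpoint m.  Two points of height m on
    either side of S are at distance at least l(S), whereas by the corridor
    condition F is almost the same on both sides at heights a and b.  So on all
    the lines close to S on one of its two sides, F(m) is at distance >= k l(S)
    from the average of F(a) and F(b).  A function which is derivable at a point
    y cannot have this property for intervals (a, b) containing y of arbitrarily
    small length.  A pigeonhole count over slits of one size along a vertical
    strip and Baire's theorem give a line, free of slits, on which the points
    covered by bad intervals of all scales form a set of positive measure.  The
    Euclidean case is an instance, by Rademacher's theorem on the line: if g is
    1-Lipschitz, the Lebesgue-Stieltjes measures of (x + g) / 2 and (x - g) / 2
    add up to Lebesgue measure, so the first one has a density, and Lebesgue
    differentiation applies. *)

Set Implicit Arguments.
Unset Strict Implicit.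
Unset Printing Implicit Defensive.

Local Open Scope classical_set_scope.
Local Open Scope ring_scope.

(** * Lipschitz functions of a real variable *)

(** The contraction bound makes x + g x nondecreasing and continuous, hence a distribution
    function. *)
Lemma cumulative_half_add (R : realType) (g : R -> R) :
  (forall x y, `|g x - g y| <= `|x - y|) ->
  exists f : cumulative R R, forall x, f x = (x + g x) / 2.
Proof.
move=> g1.
have nd : nondecreasing (fun x => (x + g x) / 2).
  move=> x y xy; rewrite ler_pM2r ?invr_gt0//.
  have := g1 y x; rewrite (ger0_norm (_ : 0 <= y - x)) ?subr_ge0//.
  by rewrite ler_norml => /andP[]; lra.
have cg : continuous g.
  move=> x; apply/cvgrPdist_le => e e0; near=> y.
  apply: (le_trans (g1 x y)).
  near: y; exact: (@cvgr_dist_le _ _ _ _ _ id x cvg_id).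
have rc : right_continuous (fun x => (x + g x) / 2).
  apply: right_continuousW => x; apply: cvgM; last exact: cvg_cst.
  by apply: cvgD; [exact: cvg_id|exact: cg].
pose c := isCumulative.Build R _ R _ nd rc.
pose f : cumulative R R := HB.pack (fun x : R => (x + g x) / 2) c.
by exists f.
Unshelve. all: by end_near. Qed.

Lemma lebesgue_stieltjes_itvoc (R : realType) (f : cumulative R R) (a b : R) :
  a <= b -> lebesgue_stieltjes_measure f `]a, b]%classic = (f b - f a)%:E.
Proof.
move=> ab; rewrite /lebesgue_stieltjes_measure /measure_extension/=.
by rewrite measurable_mu_extE/= ?wlength_itv_bnd//; exact: is_ocitv.
Qed.

Lemma contraction_ae_derivable (R : realType) (g : R -> R) :
  (forall x y, `|g x - g y| <= `|x - y|) ->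
  {ae (@lebesgue_measure R), forall t, t \in `]0, 1[ -> derivable g t 1}.
Proof.
move=> g1.
have [f1 f1E] := cumulative_half_add g1.
have [|f2 f2E] := @cumulative_half_add R (fun x => - g x).
  by move=> x y /=; rewrite -opprD normrN.
pose nu : {measure set (measurableTypeR R) -> \bar R} :=
  lebesgue_stieltjes_measure f1.
pose nu2 : {measure set (measurableTypeR R) -> \bar R} :=
  lebesgue_stieltjes_measure f2.
(* The two distribution functions add up to the identity, so both sides agree on half-open
   intervals, and these determine Lebesgue measure. *)
have nuD A : measurable A -> lebesgue_measure A = (nu A + nu2 A)%E.
  move=> mA; have -> : (nu A + nu2 A = measure_add nu nu2 A)%E.
    by rewrite measure_addE.
  apply: lebesgue_measure_unique => // X [[a b] _ <-].
  rewrite -[RHS]/(measure_add nu nu2 _) measure_addE /=.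
  have [ab|ba] := leP a b; last first.
    by rewrite set_itv_ge ?bnd_simp -?leNgt ?(ltW ba)// !measure0 adde0.
  rewrite /nu/nu2/= !lebesgue_stieltjes_itvoc// lebesgue_measure_itv/= lte_fin.
  rewrite -EFinD !f1E !f2E/=; case: ltP => ab2; last first.
    have -> : a = b by apply/eqP; rewrite eq_le ab ab2.
    by congr EFin; field.
  by congr EFin; rewrite /=; field.
have m01 : measurable (`]0, 1]%classic : set (measurableTypeR R)).
  exact: measurable_itv.
have nufin : (nu `]0%R, 1%R]%classic < +oo)%E.
  by rewrite /nu/= lebesgue_stieltjes_itvoc// ltry.
(* Restriction to ]0, 1] gives a finite measure, as Radon-Nikodym requires; its density is then
   integrable on the whole line. *)
pose nu0 : {finite_measure set (measurableTypeR R) -> \bar R} :=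
  mfrestr m01 nufin.
pose mu : {sigma_finite_measure set (measurableTypeR R) -> \bar R} :=
  lebesgue_measure.
have ac : nu0 `<< mu.
  apply/null_content_dominatesP => A mA muA0.
  rewrite /nu0 /= /mfrestr /= /mrestr.
  apply/eqP; rewrite eq_le measure_ge0 andbT.
  have mAI : measurable (A `&` `]0%R, 1%R]%classic) by exact: measurableI.
  apply: (@le_trans _ _ (lebesgue_measure (A `&` `]0%R, 1%R]%classic))).
    by rewrite nuD// leeDl.
  by rewrite -muA0; apply: le_measure; rewrite ?inE//; exact: subIsetl.
have [h [h0 hfin hint hE]] := radon_nikodym_sigma_finite ac.
pose k : R -> R := fine \o h.
have hk : h = EFin \o k by apply/funext => x; rewrite /k/= fineK.
have kint : lebesgue_measure.-integrable [set: R] (EFin \o k) by rewrite -hk.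
have kloc : locally_integrable [set: R] k.
  exact: (open_integrable_locally openT).
have kitv y : lebesgue_measure.-integrable
    [set` Interval (BRight (0 : R)) (BRight y)] (EFin \o k).
  by apply: integrableS kint => //; exact: measurable_itv.
pose F (x : R) := Rintegral lebesgue_measure
  [set` Interval (BRight 0) (BRight x)] k.
have := FTC1 kitv kloc.
apply: filterS; first exact: (ae_filter_ringOfSetsType lebesgue_measure).
move=> t /= kt; rewrite in_itv/= => /andP[t0 t1].
have [|dk _] := kt; first by rewrite lte_fin.
(* On ]0, 1[ the primitive [F x] equals (x + g x - g 0) / 2, so this function coincides with [g]
   near [t]. *)
have dg : derivable (fun x => 2 * F x + g 0 - x) t 1.
  apply: derivableB; last exact: derivable_id.
  apply: derivableD; last exact: derivable_cst.
  by apply: derivableM => //; exact: derivable_cst.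
apply: near_eq_derivable dg.
near=> x.
have x0 : 0 < x by near: x; exact: lt_nbhsr.
have x1 : x < 1 by near: x; exact: lt_nbhsl.
have : nu0 `]0, x]%classic = ((x + g x) / 2 - (0 + g 0) / 2)%:E.
  rewrite /nu0/= /mfrestr/= /mrestr.
  rewrite (_ : _ `&` _ = `]0, x]%classic).
    by rewrite /nu/= lebesgue_stieltjes_itvoc ?(ltW x0)// !f1E.
  by apply: setIidl => y; rewrite /= !in_itv/= => /andP[-> /le_trans ->//];
    exact: ltW.
rewrite hE; last exact: measurable_itv.
rewrite hk /F /Rintegral /= => ->/=.
by field.
Unshelve. all: by end_near. Qed.

(** The condition of [RNP] on a space without completeness structure, so that one argument serves
    both Banach spaces and row vectors. *)
Definition ae_derivable_lipschitz (R : realType) (X : normedModType R) : Prop :=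
  forall gamma : R -> X,
    [lipschitz gamma t | t in `[0, 1]] ->
    {ae (@lebesgue_measure R), forall t, t \in `]0, 1[ -> derivable gamma t 1}.

Lemma lipschitz_on_const (R : realType) (X : normedModType R) (A : set R)
    (g : R -> X) :
  [lipschitz g t | t in A] ->
  exists2 K : R, 0 < K & forall x y, A x -> A y -> `|g x - g y| <= K * `|x - y|.
Proof.
move=> gL; near (+oo : set_system R) => K; exists K.
  by near: K; exact: nbhs_pinfty_gt.
suff : K.-lipschitz_A g by move=> + x y Ax Ay => /(_ (x, y)); apply.
by near: K; exact: gL.
Unshelve. all: by end_near. Qed.

(** Nearest-point retraction onto [0, 1]; composition with it extends a map that is Lipschitz on
    [0, 1] to the whole line. *)
Definition clamp (R : realType) (x : R) : R :=
  if x < 0 then 0 else if 1 < x then 1 else x.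

Lemma clamp_itv (R : realType) (x : R) : clamp x \in `[0, 1].
Proof.
rewrite in_itv/= /clamp; case: ltP => [|x0]; first by rewrite lexx ler01.
by case: ltP => [|x1]; rewrite ?lexx ?ler01// x0.
Qed.

Lemma clamp_id (R : realType) (x : R) : x \in `[0, 1] -> clamp x = x.
Proof.
by rewrite in_itv/= => /andP[x0 x1]; rewrite /clamp ltNge x0/= ltNge x1.
Qed.

Lemma clamp_contraction (R : realType) (x y : R) :
  `|clamp x - clamp y| <= `|x - y|.
Proof.
have H1 : x - y <= `|x - y| := ler_norm _.
have H2 : y - x <= `|x - y| by rewrite distrC ler_norm.
rewrite ler_norml /clamp; case: (ltP x 0) => ?; case: (ltP y 0) => ?;
  case: (ltP 1 x) => ?; case: (ltP 1 y) => ?; apply/andP; split; lra.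
Qed.

(** Each coordinate, extended by [clamp] and divided by the Lipschitz constant, is a contraction,
    and a finite union of null sets is null. *)
Lemma rV_ae_derivable_lipschitz (R : realType) (n : nat) :
  @ae_derivable_lipschitz R 'rV[R]_n.
Proof.
move=> gamma /lipschitz_on_const[K K0 gK].
pose g (j : 'I_n) x : R := gamma (clamp x) ord0 j / K.
have gL j : {ae (@lebesgue_measure R), forall t,
    t \in `]0, 1[ -> derivable (g j) t 1}.
  apply: contraction_ae_derivable => x y.
  rewrite /g -mulrBl normrM normfV (gtr0_norm K0) ler_pdivrMr// mulrC.
  apply: (@le_trans _ _ `|gamma (clamp x) - gamma (clamp y)|).
    rewrite [leRHS]/Num.norm/= mx_normrE.
    by apply: le_trans (le_bigmax _ _ (ord0, j)); rewrite !mxE.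
  apply: (le_trans (gK _ _ (clamp_itv _) (clamp_itv _))).
  by rewrite ler_pM2l// clamp_contraction.
have : {ae (@lebesgue_measure R), forall t, forall j,
    t \in `]0, 1[ -> derivable (g j) t 1}.
  apply: filter_forall => //.
apply: filterS; first exact: (ae_filter_ringOfSetsType lebesgue_measure).
move=> t gt t01; apply/derivable_mxP => i j; rewrite ord1.
have dg : derivable (fun x => K * g j x) t 1.
  by apply: derivableM; [exact: derivable_cst|exact: gt].
apply: near_eq_derivable dg.
move: t01; rewrite in_itv/= => /andP[t0 t1].
near=> x.
have x01 : x \in `[0, 1].
  by rewrite in_itv/=; apply/andP; split; apply: ltW; near: x;
    [exact: lt_nbhsr|exact: lt_nbhsl].
rewrite /g (clamp_id x01) [LHS]mulrC divfK//; exact: lt0r_neq0.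
Unshelve. all: by end_near. Qed.

(** * Intersections of layers of thick boxes *)

Lemma pigeonhole_card (N K : nat) (f : 'I_N -> 'I_K.+1) :
  exists k, (N <= K.+1 * #|[pred i | f i == k]|)%N.
Proof.
apply/existsP; apply: contraT; rewrite negb_exists => /forallP fN.
case: N => [|N] in f fN *; first by have := fN ord0; rewrite -ltnNge ltn0.
have : (\sum_(k < K.+1) K.+1 * #|[pred i | f i == k]| <= \sum_(k < K.+1) N)%N.
  by apply: leq_sum => k _; rewrite -ltnS ltnNge fN.
rewrite -big_distrr/= sum_nat_const card_ord.
suff -> : (\sum_(k < K.+1) #|[pred i | f i == k]| = N.+1)%N.
  by rewrite leq_pmul2l// ltnn.
transitivity (\sum_(i < N.+1) 1)%N; last by rewrite sum1_card card_ord.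
rewrite (partition_big f xpredT)//=; apply: eq_bigr => k _.
by rewrite sum1_card.
Qed.

(** The witness is the first grid point beyond [u]; it is at most [h] away from [u]. *)
Lemma grid_hit (R : realType) (p h u v : R) :
  0 < h -> p <= u -> h < v - u ->
  exists k : nat, u < p + k%:R * h < v.
Proof.
move=> h0 pu huv; exists (Num.trunc ((u - p) / h)).+1.
have /trunc_itv : 0 <= (u - p) / h by rewrite divr_ge0 ?subr_ge0// ltW.
rewrite ler_pdivlMr// ltr_pdivrMr// -natr1 => /andP[? ?].
by apply/andP; split; lra.
Qed.

Section thick_boxes.
(** In the application [T] is the type of slits, ]a, b[ is the vertical extent of a slit, and ]u, v[
    is the window of abscissas, on one side of it, where the midpoint deviation is large. [box]
    expresses that slits occur at every scale and location. *)
Variables (R : realType) (T : Type) (D : set T) (u v a b : T -> R).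
Variables (theta delta C0 : R).
Hypotheses (theta0 : 0 < theta) (delta0 : 0 < delta) (C00 : 0 < C0).
Hypothesis ab01 : forall i, D i -> 0 <= a i /\ b i <= 1.
Hypothesis box : forall x y r : R, 0 <= x <= 1 -> 0 <= y <= 1 -> 0 < r < 1 ->
  exists i, [/\ D i, x - 2 * r <= u i /\ v i <= x + 2 * r,
    theta * r <= v i - u i, delta * r <= b i - a i <= C0 * r &
    forall t, a i < t < b i -> `|t - y| < r].

Definition layer (n : nat) (x : R) : set R :=
  \bigcup_(i in [set i | [/\ D i, u i < x < v i & b i - a i < n.+1%:R^-1]])
    `]a i, b i[%classic.

Lemma open_layer n x : open (layer n x).
Proof. by apply: bigcup_open => i _; exact: interval_open. Qed.

Lemma layer_nonincreasing n m x : (n <= m)%N -> layer m x `<=` layer n x.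
Proof.
move=> nm t [i [Di xi bi] ti]; exists i => //; split => //.
by apply: (lt_le_trans bi); rewrite lef_pV2 ?posrE// ler_nat.
Qed.

(** Boxes of size about 1 / N are stacked along a thin vertical strip. A fixed proportion of their
    windows share an abscissa, and the corresponding disjoint intervals have total length bounded
    below independently of [s], [t] and [n]. *)
Lemma layer_thick : exists2 beta : R, 0 < beta & forall (s t : R) n,
  0 <= s -> s < t -> t <= 1 ->
  exists2 q : R, s < q < t & \forall x \near q,
    (beta%:E <= lebesgue_measure (layer n x))%E.
Proof.
(* Windows of length at least theta r lie in a strip of width 4 r, so a grid of K + 1 > 4 / theta
   cells meets each of them. *)
pose K := Num.trunc (4 / theta).
have K4 : 4 < K.+1%:R * theta.
  have /trunc_itv : 0 <= 4 / theta by rewrite divr_ge0// ltW.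
  by rewrite ltr_pdivrMr// => /andP[].
exists (delta / (2 * K.+1%:R)); first by rewrite divr_gt0// mulr_gt0.
move=> s t n s0 st t1.
(* The first summand makes the strip, of width 4 r = 2 / N, fit into ]s, t[; the second makes the
   slits, of length at most C0 r, shorter than 1 / (n + 1). *)
pose M := Num.trunc (2 / (t - s) + C0 * n.+1%:R).
pose N := M.+1.
have Npos : 0 < N%:R :> R by [].
have [Nst NC] : 2 / (t - s) < N%:R /\ C0 * n.+1%:R < N%:R.
  have : 0 < 2 / (t - s) by rewrite divr_gt0// subr_gt0.
  have : 0 < C0 * n.+1%:R by rewrite mulr_gt0.
  move=> A B; have /trunc_itv : 0 <= 2 / (t - s) + C0 * n.+1%:R by lra.
  by rewrite -/M -/N => /andP[_ ?]; split; lra.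
pose r : R := (2 * N%:R)^-1.
have r0 : 0 < r by rewrite invr_gt0 mulr_gt0.
have Nr : N%:R * r = 2^-1 by rewrite /r; field; rewrite gt_eqF.
have r1 : r < 1.
  rewrite -(ltr_pM2l Npos) Nr mulr1.
  have : (1 : R) <= N%:R by rewrite ler1n.
  by lra.
pose x0 : R := (s + t) / 2.
have rst : 4 * r < t - s.
  rewrite -(ltr_pM2l Npos) mulrCA Nr.
  by move: Nst; rewrite ltr_pdivrMr ?subr_gt0//; lra.
(* As 2 N r = 1, the intervals of radius [r] about these centres are disjoint and fill [0, 1] up to
   endpoints. *)
pose y (i : 'I_N) : R := (2 * i%:R + 1) * r.
have y01 i : 0 <= y i <= 1.
  apply/andP; split; first by rewrite mulr_ge0 ?ltW// ltr_wpDl// mulr_ge0.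
  have : (i%:R + 1 : R) <= N%:R by rewrite natr1 ler_nat ltn_ord.
  move=> iN; rewrite /y; apply: (@le_trans _ _ (2 * (N%:R * r)));
    last by rewrite Nr; lra.
  by rewrite mulrA ler_pM2r//; lra.
have /choice[j jP] : forall i : 'I_N, exists j, [/\ D j, x0 - 2 * r <= u j /\
    v j <= x0 + 2 * r, theta * r <= v j - u j,
    delta * r <= b j - a j <= C0 * r &
    forall t, a j < t < b j -> `|t - y i| < r].
  by move=> i; apply: box => //; rewrite ?r0 ?r1// /x0; apply/andP; split; lra.
(* Each window (u, v) is longer than the mesh h of the grid x0 - 2 r + k h and
   contains a grid point; some point lies in at least N / (K + 1) windows. *)
pose h : R := 4 * r / K.+1%:R.
have h0 : 0 < h by rewrite divr_gt0// mulr_gt0.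
have Kh : K.+1%:R * h = 4 * r by rewrite /h mulrC divfK.
have /choice[f fP] : forall i : 'I_N, exists k : 'I_K.+1,
    u (j i) < (x0 - 2 * r) + k%:R * h < v (j i).
  move=> i; have [_ [uj vj] uv _ _] := jP i.
  have [|k /andP[k1 k2]] := grid_hit h0 uj (v := v (j i)).
    apply: lt_le_trans uv; rewrite -(@ltr_pM2l _ K.+1%:R)// Kh mulrA.
    by rewrite ltr_pM2r.
  have kK : (k < K.+1)%N.
    rewrite -(ltr_nat R) -(ltr_pM2r h0) Kh; lra.
  by exists (Ordinal kK); rewrite /= k1 k2.
have [k kP] := pigeonhole_card f.
exists ((x0 - 2 * r) + k%:R * h).
  have kK : k%:R * h < 4 * r by rewrite -Kh ltr_pM2r// ltr_nat.
  have k0 : 0 <= k%:R * h by rewrite mulr_ge0// ltW.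
  by rewrite /x0; apply/andP; split; lra.
(* The windows are open and finitely many, so all those containing the grid point also contain every
   nearby point. *)
have near_k (i : 'I_N) :
    \forall x \near (x0 - 2 * r) + k%:R * h, f i == k -> u (j i) < x < v (j i).
  have [/eqP fik|fik] := boolP (f i == k); last by near=> x.
  have /andP[fi1 fi2] := fP i; rewrite fik in fi1 fi2.
  by near=> x; move=> _; apply/andP; split; near: x;
    [exact: lt_nbhsr|exact: lt_nbhsl].
have near_all : \forall x \near (x0 - 2 * r) + k%:R * h,
    forall i : 'I_N, f i == k -> u (j i) < x < v (j i).
  apply: (@filter_forall R 'I_N
    (fun i x => f i == k -> u (j i) < x < v (j i)) (nbhs _)).
  exact: near_k.
near=> x.
have xP (i : 'I_N) : f i == k -> u (j i) < x < v (j i).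
  by move: i; near: x.
pose F i : set R := `]a (j i), b (j i)[%classic.
have tF : trivIset [set: 'I_N] F.
  apply/trivIsetP => i1 i2 _ _ i12; rewrite -subset0 => z [].
  rewrite /F/= !in_itv/= => z1 z2.
  have [_ _ _ _ /(_ _ z1)] := jP i1; have [_ _ _ _ /(_ _ z2)] := jP i2.
  have rB (m m' : nat) : (m < m')%N -> `|z - (2 * m'%:R + 1) * r| < r ->
      `|z - (2 * m%:R + 1) * r| < r -> False.
    move=> mm'; rewrite !ltr_distl => /andP[A1 _] /andP[_ A2].
    have : (m%:R + 1) * r <= m'%:R * r by rewrite natr1 ler_pM2r// ler_nat.
    by lra.
  case: (ltngtP i1 i2) => [i1i2|i2i1|/val_inj i12e].
  - by move=> ? ?; exact: (rB i1 i2).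
  - by move=> ? ?; exact: (rB i2 i1).
  - by rewrite i12e eqxx in i12.
have mF i : measurable (F i) by exact: measurable_itv.
apply: (@le_trans _ _
  (lebesgue_measure (\big[setU/set0]_(i < N | f i == k) F i))).
  rewrite measure_bigsetU_ord//.
  apply: (@le_trans _ _ (\sum_(i < N | f i == k) (delta * r)%:E)%E).
    rewrite sumEFin lee_fin sumr_const -[leRHS]mulr_natr.
    rewrite (@eq_card _ _ [pred i | f i == k])// ler_pdivrMr ?mulr_gt0//.
    have : (N%:R : R) <= K.+1%:R * #|[pred i | f i == k]|%:R.
      by rewrite -natrM ler_nat.
    rewrite -(ler_pM2r r0) Nr -(ler_pM2l delta0); lra.
  apply: lee_sum => i _.
  rewrite -[leRHS]/(lebesgue_measure `]a (j i), b (j i)[%classic).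
  rewrite lebesgue_measure_itv/= lte_fin.
  have [_ _ _ /andP[ab1 ab2] _] := jP i.
  have dr : 0 < delta * r by rewrite mulr_gt0.
  by rewrite ifT -?EFinD ?lee_fin//; lra.
apply: le_measure; rewrite ?inE.
- apply: bigsetU_measurable => i _; exact: measurable_itv.
- apply: measurable_realfun.open_measurable; exact: open_layer.
- rewrite -bigcup_pred => z [i /= fik zi]; exists (j i) => //=; split.
  + by have [] := jP i.
  + exact: xP.
  + have [_ _ _ /andP[_ ab2] _] := jP i.
    apply: (le_lt_trans ab2); rewrite -(ltr_pM2r (ltr0Sn R n)) mulVf//.
    rewrite mulrAC -(ltr_pM2r Npos) mul1r -[ltLHS]mulrA [r * _]mulrC Nr.
    have : 0 < C0 * n.+1%:R by rewrite mulr_gt0.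
    by lra.
Unshelve. all: by end_near. Qed.

(** Baire's theorem gives an abscissa outside [X0] where all layers have measure at least beta;
    continuity from above passes this bound to their intersection. *)
Lemma limsup_layer_thick (X0 : set R) : countable X0 ->
  exists x, [/\ 0 < x < 1, ~ X0 x &
    (0 < lebesgue_measure (\bigcap_n layer n x))%E].
Proof.
move=> /countable_injP[e einj]; have [beta beta0 betaP] := layer_thick.
(* The guard 0 < x < 1 makes the condition vacuous elsewhere, so that [G n] is dense in the whole
   line. *)
pose G n : set R := interior
  [set x | 0 < x < 1 -> (beta%:E <= lebesgue_measure (layer n x))%E].
(* By injectivity of [e] at most one point is removed at each stage, and every point of [X0] is
   removed at some stage. *)
pose V n := G n `&` ~` [set x | X0 x /\ e x = n].
have oV n : open (V n).
  apply: openI; first exact: open_interior.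
  apply: closed_openC.
  have [[w [Xw ewn]]|] := pselect (exists w, X0 w /\ e w = n).
    rewrite (_ : [set _ | _] = [set w]); first exact: closed_eq.
    apply/seteqP; split => [x [Xx exn]|x ->//].
    by apply: einj; rewrite ?inE// exn ewn.
  move=> nX; rewrite (_ : [set _ | _] = set0); first exact: closed0.
  by apply/seteqP; split => // x Xx; apply: nX; exists x.
have dG n : dense (G n).
  move=> O [p Op] oO.
  have /nbhs_ballP[d /= d0 dO] : nbhs p O by exact: open_nbhs_nbhs.
  (* Either the ball about [p] misses ]0, 1[, or it meets it in the interval ]s, t[ below. *)
  have [/andP[p0 p1]|p01] := boolP ((- d < p) && (p < 1 + d)); last first.
    exists p; split => //; apply/nbhs_ballP; exists d => // y.
    rewrite /ball/= ltr_distlC => /andP[y1 y2] /andP[y3 y4].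
    by exfalso; apply/negP : p01; apply/negPn; apply/andP; split; lra.
  pose s := Num.max 0 (p - d); pose t := Num.min 1 (p + d).
  have [s0 sp] : 0 <= s /\ p - d <= s by rewrite /s !le_max !lexx orbT.
  have [t1 tp] : t <= 1 /\ t <= p + d by rewrite /t !ge_min !lexx orbT.
  have st : s < t.
    rewrite /s/t gt_max !lt_min ltr01/=; apply/and3P; split; lra.
  have [q /andP[sq qt] nq] := betaP s t n s0 st t1.
  exists q; split.
    by apply: dO; rewrite /ball/= ltr_distlC; apply/andP; split; lra.
  by rewrite /G /interior /=; apply: (filterS _ nq) => x xb _.
have dV n : dense (V n).
  move=> O O0 oO.
  have [p [Op Gp]] := dG n O O0 oO.
  have /nbhs_ballP[d /= d0 dOG] : nbhs p (O `&` G n).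
    by apply: open_nbhs_nbhs; split => //; apply: openI => //;
      exact: open_interior.
  have [Xp|Xp] := pselect (X0 p /\ e p = n); last by exists p.
  have [Oq Gq] : (O `&` G n) (p + d / 2).
    by apply: dOG; rewrite /ball/= ltr_distlC; apply/andP; split; lra.
  exists (p + d / 2); split => //; split => // -[Xq eq_n].
  have : p + d / 2 = p by apply: einj; rewrite ?inE ?eq_n; case: Xp.
  by lra.
have dcap : dense (\bigcap_n V n) by exact: (@Baire R R).
have o01 : open (`]0, 1[%classic : set R) by exact: interval_open.
have [|x []] := dcap _ _ o01.
  by exists (1 / 2); rewrite /= in_itv/=; apply/andP; split; lra.
rewrite /= in_itv/= => x01 Vx.
exists x; split => //.
- by move=> Xx; have [_] := Vx (e x) I; apply.
- have lay n : (beta%:E <= lebesgue_measure (layer n x))%E.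
    by have [/interior_subset Gx _] := Vx n I; exact: Gx.
  have mlay n : measurable (layer n x).
    apply: measurable_realfun.open_measurable; exact: open_layer.
  apply: (@lt_le_trans _ _ beta%:E); first by rewrite lte_fin.
  have mcap : measurable (\bigcap_n layer n x).
    by apply: bigcapT_measurable => n; exact: mlay.
  have fin0 : (lebesgue_measure (layer 0 x) < +oo)%E.
    apply: (@le_lt_trans _ _ (lebesgue_measure (`[0%R, 1%R]%classic : set R))).
      apply: le_measure; rewrite ?inE;
        [exact: mlay|exact: measurable_itv|move=> y [i [Di _ _]]].
      have [a0 b1] := ab01 Di.
      by rewrite /= !in_itv/= => /andP[? ?]; apply/andP; split; lra.
    by rewrite lebesgue_measure_itv/= lte_fin ltr01 -EFinB ltry.
  have cv : lebesgue_measure (layer n x) @[n --> \oo] -->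
      lebesgue_measure (\bigcap_n layer n x).
    apply: (nonincreasing_cvg_mu fin0) => // m n mn.
    by apply/subsetPset; exact: layer_nonincreasing.
  rewrite -(cvg_lim _ cv)//; apply: lime_ge.
    by apply/cvg_ex; eexists; exact: cv.
  exact: nearW.
Qed.

End thick_boxes.

(** * The path distance *)

Section path_distance.
Variable R : realType.
Implicit Types (p q : R * R) (Z : set (R * R)).

Lemma plane_dist_ge1 p q : `|p.1 - q.1| <= plane_dist p q.
Proof. by rewrite -sqrtr_sqr ler_wsqrtr// lerDl sqr_ge0. Qed.

Lemma plane_dist_ge2 p q : `|p.2 - q.2| <= plane_dist p q.
Proof. by rewrite -sqrtr_sqr ler_wsqrtr// lerDr sqr_ge0. Qed.

Lemma plane_dist_vertical (x y y' : R) : plane_dist (x, y) (x, y') = `|y - y'|.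
Proof. by rewrite /plane_dist/= subrr expr0n/= add0r sqrtr_sqr. Qed.

Lemma plane_dist_horizontal (x x' y : R) :
  plane_dist (x, y) (x', y) = `|x - x'|.
Proof. by rewrite /plane_dist/= subrr expr0n/= addr0 sqrtr_sqr. Qed.

Definition segment_path p q (t : R) : R * R :=
  (p.1 + t * (q.1 - p.1), p.2 + t * (q.2 - p.2)).

Lemma plane_dist_segment_path p q s t :
  plane_dist (segment_path p q s) (segment_path p q t) =
  `|t - s| * plane_dist p q.
Proof.
rewrite -sqrtr_sqr -sqrtrM ?sqr_ge0//; congr Num.sqrt; rewrite /=; ring.
Qed.

Lemma sum_increments (a : R) s : path <%O a s ->
  \sum_(i < size s) `|nth 0 s i - nth 0 (a :: s) i| = last a s - a.
Proof.
elim: s a => [|b s IH] a /=; first by rewrite big_ord0 subrr.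
move=> /andP[ab /IH {}IH]; rewrite big_ord_recl/= IH gtr0_norm ?subr_gt0//.
by ring.
Qed.

(** For the straight path the increments along any partition telescope to the distance of its
    ends. *)
Lemma path_dist_segment Z p q :
  (forall t, 0 <= t <= 1 -> Z (segment_path p q t)) ->
  (path_dist Z p q <= (plane_dist p q)%:E)%E.
Proof.
move=> Zpq; apply: (@le_trans _ _ (curve_length (segment_path p q))).
  apply: ereal_inf_lbound; exists (segment_path p q) => //; split.
  - apply: continuous_subspaceT => t.
    have cline (u w : R) : u + s * w @[s --> t] --> u + t * w.
      by apply: cvgD; [exact: cvg_cst|
        apply: cvgM; [exact: cvg_id|exact: cvg_cst]].
    exact: (cvg_pair (cline _ _) (cline _ _)).
  - by rewrite /segment_path !mul0r !addr0; case: p {Zpq}.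
  - by rewrite /segment_path; case: q {Zpq} => u w /=; congr pair; ring.
  - by move=> _ [t /= + <-]; rewrite in_itv/=; exact: Zpq.
apply: ge_ereal_sup => _ [s [ps /eqP ls] <-]; rewrite lee_fin.
under eq_bigr do rewrite plane_dist_segment_path.
by rewrite -mulr_suml sum_increments// ls subr0 mul1r.
Qed.

(** The path crosses the line that carries [S] at a point outside [S], hence at vertical distance at
    least l(S) / 2 from the midpoint. Going there and coming back each cost that much. *)
Lemma path_dist_across (SS : set (slit R)) (S : slit R) p q :
  SS S -> p.1 < slit_x S < q.1 ->
  p.2 = (slit_a S + slit_b S) / 2 -> q.2 = (slit_a S + slit_b S) / 2 ->
  ((slit_length S)%:E <= path_dist (slit_domain SS) p q)%E.
Proof.
move=> SSS /andP[pS Sq] p2 q2.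
apply: le_ereal_inf_tmp => _ [g [cg g0 g1 gZ] <-].
have cg1 : {within `[0, 1], continuous (fst \o g)}.
  by move=> t; apply: (cvg_comp _ _ (cg t)); exact: cvg_fst.
have [|t t01 gt] := @IVT _ (fst \o g) 0 1 (slit_x S) ler01 cg1.
  rewrite /= g0 g1 ge_min le_max (ltW pS) (ltW Sq) orbT//.
(* The partition 0 < t < 1 used below has to be strict. *)
have t0 : 0 < t.
  rewrite lt_neqAle; move: t01; rewrite in_itv/= => /andP[-> _]; rewrite andbT.
  by apply/eqP => t0; move: gt pS; rewrite -t0/= g0 => ->; rewrite ltxx.
have t1 : t < 1.
  rewrite lt_neqAle; move: t01; rewrite in_itv/= => /andP[_ ->]; rewrite andbT.
  by apply/eqP => t1; move: gt Sq; rewrite t1/= g1 => ->; rewrite ltxx.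
have ab := slit_a_lt_b S.
have far : slit_length S / 2 <= `|(g t).2 - (slit_a S + slit_b S) / 2|.
  rewrite leNgt; apply/negP; rewrite ltr_norml /slit_length => /andP[h1 h2].
  have [_] : slit_domain SS (g t) by apply: gZ; exists t.
  apply; exists S => //; split => //=; rewrite in_itv/=.
  by apply/andP; split; lra.
apply: (@le_trans _ _ (plane_dist (g 0) (g t) + plane_dist (g t) (g 1))%:E).
  rewrite lee_fin; have := plane_dist_ge2 (g 0) (g t).
  have := plane_dist_ge2 (g t) (g 1).
  by rewrite g0 g1 p2 q2 [X in _ -> X <= _ -> _]distrC; move: far; lra.
apply: ereal_sup_ubound; exists [:: t; 1].
  by split => /=; rewrite ?t0 ?t1.
by rewrite /= !big_ord_recl big_ord0/= addr0.
Qed.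

End path_distance.

(** * Deviation from the midpoint *)

Section midpoint_defect.
Variables (R : realType) (X : normedModType R).

(** A second-order difference, up to the factor - 1 / 2: it is linear in [g] and vanishes on affine
    maps. *)
Definition midpoint_defect (g : R -> X) (a b : R) : X :=
  g ((a + b) / 2) - 2^-1 *: (g a + g b).

Lemma midpoint_defectB (g h : R -> X) a b :
  midpoint_defect (g \- h) a b = midpoint_defect g a b - midpoint_defect h a b.
Proof.
rewrite /midpoint_defect/= [g a - _ + _]addrACA -opprD scalerBr.
by rewrite !opprB addrACA [RHS]addrACA; congr (_ + _); exact: addrC.
Qed.

Lemma midpoint_defect_affine (p w : X) a b :
  midpoint_defect (fun t => p + t *: w) a b = 0.
Proof.
rewrite /midpoint_defect.
have -> : (p + a *: w) + (p + b *: w) = 2 *: (p + ((a + b) / 2) *: w).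
  by rewrite addrACA -scalerDl scalerDr scalerA scaler_nat mulr2n mulrC divfK.
by rewrite scalerA mulVf// scale1r subrr.
Qed.

(** Subtracting the tangent line at [y] leaves the defect unchanged, and the remainder is o(b - a)
    at [a], [b] and the midpoint, wherever [y] lies in between. *)
Lemma midpoint_defect_derivable (g : R -> X) (y k : R) :
  derivable g y 1 -> 0 < k ->
  exists2 d : R, 0 < d & forall a b, a < y < b -> b - a < d ->
    `|midpoint_defect g a b| < k * (b - a).
Proof.
move=> /cvg_ex[/= w gw] k0.
(* The midpoint contributes k / 4 and the average of the ends another k / 4, so the total k / 2 is
   strictly below k. *)
have k40 : 0 < k / 4 by rewrite divr_gt0.
have /cvgrPdist_le/(_ _ k40)[d /= d0 dP] := gw.
exists d => // a b /andP[ay yb] bad.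
pose rho t := g t - ((g y - y *: w) + t *: w).
have rhoP t : `|t - y| < d -> `|rho t| <= k / 4 * `|t - y|.
  have [->|ty] := eqVneq t y.
    by rewrite /rho subrK !subrr !normr0 mulr0.
  have ty0 : t - y != 0 by rewrite subr_eq0.
  move=> tyd; have /(_ _ ty0) := dP (t - y).
  rewrite /ball_/= sub0r normrN => /(_ tyd).
  rewrite -(ler_pM2r (_ : 0 < `|t - y|)) ?normr_gt0//.
  rewrite [`|w - _| * _]mulrC -normrZ scalerBr scalerA divff// scale1r.
  rewrite [_ *: 1]mulr1 subrK distrC; congr (`|_| <= _).
  rewrite /rho scalerBl !opprD !opprK !addrA.
  exact: addrAC.
have -> : midpoint_defect g a b = midpoint_defect rho a b.
  have -> : rho = g \- (fun t => (g y - y *: w) + t *: w) by [].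
  by rewrite midpoint_defectB midpoint_defect_affine subr0.
have ra : `|rho a| <= k / 4 * (b - a).
  apply: (le_trans (rhoP a _)); rewrite ler0_norm ?ler_pM2l//; lra.
have rb : `|rho b| <= k / 4 * (b - a).
  apply: (le_trans (rhoP b _)); rewrite ger0_norm ?ler_pM2l//; lra.
have rm : `|rho ((a + b) / 2)| <= k / 4 * (b - a).
  have : `|(a + b) / 2 - y| <= b - a.
    by rewrite ler_norml; apply/andP; split; lra.
  move=> my; apply: (le_trans (rhoP _ _)); first exact: le_lt_trans bad.
  by rewrite ler_pM2l.
apply: (le_lt_trans (ler_normB _ _)); rewrite normrZ gtr0_norm//.
have := ler_normD (rho a) (rho b).
have : 0 < k * (b - a) by rewrite mulr_gt0//; lra.
by lra.
Qed.

(** If two curves are close at both ends but far apart in the middle, one of them must have a large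
    defect. *)
Lemma midpoint_le_defects (g h : R -> X) (a b : R) :
  `|g ((a + b) / 2) - h ((a + b) / 2)| <=
  `|midpoint_defect g a b| + `|midpoint_defect h a b|
  + 2^-1 * (`|g a - h a| + `|g b - h b|).
Proof.
have -> : g ((a + b) / 2) - h ((a + b) / 2) =
    midpoint_defect g a b - midpoint_defect h a b
    + 2^-1 *: ((g a - h a) + (g b - h b)).
  by rewrite -midpoint_defectB /midpoint_defect/= subrK.
apply: (le_trans (ler_normD _ _)); apply: lerD; first exact: ler_normB.
by rewrite normrZ gtr0_norm// ler_pM2l// ler_normD.
Qed.

End midpoint_defect.

(** * Slit carpets *)

Section carpet.
Variables (R : realType) (SS : set (slit R)).

Lemma vertical_slit_domain x y : 0 <= x <= 1 -> ~ (@slit_x R @` SS) x ->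
  0 <= y <= 1 -> slit_domain SS (x, y).
Proof.
move=> x01 xS y01; split; first by split; rewrite /= in_itv.
by move=> [S SSS [/= xE _]]; apply: xS; exists S.
Qed.

Lemma slit_ball (S : slit R) x y r : slit_set S `<=` plane_ball (x, y) r ->
  `|slit_x S - x| < r /\ forall t, slit_a S < t < slit_b S -> `|t - y| < r.
Proof.
move=> Sr; have ball t : slit_a S < t < slit_b S ->
    plane_dist (x, y) (slit_x S, t) < r.
  by move=> t01; apply: Sr; split => //=; rewrite in_itv.
split=> [|t tab].
  apply: le_lt_trans (ball ((slit_a S + slit_b S) / 2) _).
    by rewrite distrC; exact: (plane_dist_ge1 (x, y) (slit_x S, _)).
  by have := slit_a_lt_b S; move=> ?; apply/andP; split; lra.
by apply: le_lt_trans (ball t tab); rewrite distrC;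
  exact: (plane_dist_ge2 (x, y) (slit_x S, t)).
Qed.

Variables (X : normedModType R) (M : completeMetricType R).
Variables (iota : R * R -> M) (f : M -> X) (c C : R).
Hypotheses (c0 : 0 < c) (cC : c <= C).
Hypothesis iotaE : forall p q, slit_domain SS p -> slit_domain SS q ->
  (mdist (iota p) (iota q))%:E = path_dist (slit_domain SS) p q.
Hypothesis fP : forall z z' : M,
  c * mdist z z' <= `|f z - f z'| <= C * mdist z z'.

Let F x y := f (iota (x, y)).
Let C0 : 0 < C := lt_le_trans c0 cC.

(** The vertical segment stays in the domain, so its Euclidean length bounds the path distance. *)
Lemma vertical_lipschitz x y y' : 0 <= x <= 1 -> ~ (@slit_x R @` SS) x ->
  0 <= y <= 1 -> 0 <= y' <= 1 -> `|F x y - F x y'| <= C * `|y - y'|.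
Proof.
move=> x01 xS y01 y'01; have /andP[_] := fP (iota (x, y)) (iota (x, y')).
move/le_trans; apply; rewrite ler_pM2l// -lee_fin.
rewrite iotaE; [|exact: vertical_slit_domain..].
rewrite -(plane_dist_vertical x); apply: path_dist_segment => t /andP[t0 t1].
rewrite /segment_path/= subrr mulr0 addr0; apply: vertical_slit_domain => //.
move: y01 y'01 => /andP[? ?] /andP[? ?]; apply/andP; split; nra.
Qed.

Lemma corridor_lipschitz (l r x x' y : R) :
  `[l, r] `*` [set y] `<=` slit_domain SS ->
  l <= x <= r -> l <= x' <= r -> `|F x y - F x' y| <= C * `|x - x'|.
Proof.
move=> lr xlr x'lr; have /andP[_] := fP (iota (x, y)) (iota (x', y)).
move/le_trans; apply; rewrite ler_pM2l// -lee_fin.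
rewrite iotaE; [|by apply: lr; split => //=; rewrite in_itv..].
rewrite -(plane_dist_horizontal _ _ y).
apply: path_dist_segment => t /andP[t0 t1].
rewrite /segment_path/= subrr mulr0 addr0; apply: lr; split => //=.
rewrite in_itv/=.
move: xlr x'lr => /andP[? ?] /andP[? ?]; apply/andP; split; nra.
Qed.

Lemma across_slit (S : slit R) x x' : SS S -> x < slit_x S < x' ->
  0 <= x <= 1 -> ~ (@slit_x R @` SS) x ->
  0 <= x' <= 1 -> ~ (@slit_x R @` SS) x' ->
  c * slit_length S <= `|F x ((slit_a S + slit_b S) / 2) -
    F x' ((slit_a S + slit_b S) / 2)|.
Proof.
move=> SSS xSx' x01 xS x'01 x'S; set m := _ / 2.
have m01 : 0 <= m <= 1.
  have := slit_a_gt0 S; have := slit_a_lt_b S; have := slit_b_lt1 S.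
  by rewrite /m => ? ? ?; apply/andP; split; lra.
have /andP[+ _] := fP (iota (x, m)) (iota (x', m)).
apply: le_trans; rewrite ler_pM2l// -lee_fin.
rewrite iotaE; [|exact: vertical_slit_domain..].
exact: path_dist_across.
Qed.

(** Crossing [S] at mid-height costs c l, while the corridors account for at most c l / 2. The two
    defects therefore add up to at least c l / 2, and one of them is at least c l / 4. *)
Lemma thick_side (eta e : R) (S : slit R) : 0 < e -> e <= eta ->
  4 * C * e <= c -> SS S ->
  (let J := `[slit_x S - eta * slit_length S, slit_x S + eta * slit_length S] in
    [set` J] `*` [set slit_a S] `<=` slit_domain SS /\
    [set` J] `*` [set slit_b S] `<=` slit_domain SS) ->
  exists uv : R * R, [/\ slit_x S - e * slit_length S <= uv.1,
    uv.2 <= slit_x S + e * slit_length S, uv.2 - uv.1 = e * slit_length S &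
    forall x, uv.1 < x < uv.2 -> ~ (@slit_x R @` SS) x ->
      c / 4 * slit_length S <= `|midpoint_defect (F x) (slit_a S) (slit_b S)|].
Proof.
move=> e0 eeta Cec SSS /= [corA corB].
set l := slit_length S; have l0 : 0 < l by rewrite subr_gt0 slit_a_lt_b.
have el0 : 0 < e * l by rewrite mulr_gt0.
have eetal : e * l <= eta * l by rewrite ler_pM2r.
set D := fun x => midpoint_defect (F x) (slit_a S) (slit_b S).
(* The corridor lies in the unit square, so its abscissas stay in [0, 1]. *)
have Sin x : slit_x S - eta * l <= x <= slit_x S + eta * l -> 0 <= x <= 1.
  move=> xS; have [[/= + _] _] : slit_domain SS (x, slit_a S).
    by apply: corA; split => //=; rewrite in_itv.
  by rewrite in_itv.
(* If the left side contains a single line with a small defect, comparison with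
   that line makes the defect large on the whole right side. *)
have [left|] := pselect (forall x, slit_x S - e * l < x < slit_x S ->
    ~ (@slit_x R @` SS) x -> c / 4 * l <= `|D x|).
  exists (slit_x S - e * l, slit_x S); split => //=; lra.
move=> /existsNP[x1 /not_implyP[x1S /not_implyP[x1n /negP]]].
rewrite -ltNge => Dx1; exists (slit_x S, slit_x S + e * l); split => //=.
- lra.
- lra.
move=> x2 x2S x2n.
move: x1S x2S => /andP[x11 x12] /andP[x21 x22].
have x1l : slit_x S - eta * l <= x1 <= slit_x S + eta * l.
  by apply/andP; split; lra.
have x2l : slit_x S - eta * l <= x2 <= slit_x S + eta * l.
  by apply/andP; split; lra.
have := across_slit SSS (x := x1) (x' := x2).
rewrite x12 x21 => /(_ isT (Sin _ x1l) x1n (Sin _ x2l) x2n) far.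
have nA := corridor_lipschitz corA x1l x2l.
have nB := corridor_lipschitz corB x1l x2l.
have x12e : `|x1 - x2| <= 2 * (e * l).
  by rewrite ler_norml; apply/andP; split; lra.
have Cx : C * `|x1 - x2| <= c * l / 2.
  apply: (@le_trans _ _ (C * (2 * (e * l)))); first by rewrite ler_pM2l.
  have : 4 * C * e * l <= c * l by rewrite ler_pM2r.
  by lra.
have := midpoint_le_defects (F x1) (F x2) (slit_a S) (slit_b S).
rewrite -/(D x1) -/(D x2) => tri.
rewrite -/(D x2) -/l; rewrite -/l in far Dx1.
by move: Dx1; lra.
Qed.

Lemma no_bilipschitz : ae_derivable_lipschitz X ->
  generalized_slit_collection SS -> False.
Proof.
move=> XRNP [cSS _ [K [delta [K0 delta0 scale]]] _ [eta [/andP[eta0 _] cor]]].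
(* The three bounds keep the window within the corridors, give 4 C e <= c, and give e l(S) <= r when
   l(S) <= K r, so that a window whose slit lies within [r] of [x] stays within 2 r of [x]. *)
pose e := Num.min eta (Num.min (c / (4 * C)) K^-1).
have e0 : 0 < e by rewrite !lt_min eta0 divr_gt0 ?mulr_gt0 ?invr_gt0.
have eeta : e <= eta by rewrite ge_min lexx.
have Cec : 4 * C * e <= c.
  by rewrite mulrC -ler_pdivlMr ?mulr_gt0// !ge_min lexx orbT.
have eK : e * K <= 1 by rewrite -ler_pdivlMr// mul1r !ge_min lexx !orbT.
have /choice[uv uvP] : forall S, exists uv : R * R, SS S ->
    [/\ slit_x S - e * slit_length S <= uv.1,
    uv.2 <= slit_x S + e * slit_length S, uv.2 - uv.1 = e * slit_length S &
    forall x, uv.1 < x < uv.2 -> ~ (@slit_x R @` SS) x ->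
      c / 4 * slit_length S <= `|midpoint_defect (F x) (slit_a S) (slit_b S)|].
  move=> S; have [SSS|] := pselect (SS S); last by exists (0, 0).
  by have [uv uvP] := thick_side e0 eeta Cec SSS (cor S SSS); exists uv.
have box x y r : 0 <= x <= 1 -> 0 <= y <= 1 -> 0 < r < 1 ->
    exists S, [/\ SS S, x - 2 * r <= (uv S).1 /\ (uv S).2 <= x + 2 * r,
    e * delta * r <= (uv S).2 - (uv S).1,
    delta * r <= slit_b S - slit_a S <= K * r &
    forall t, slit_a S < t < slit_b S -> `|t - y| < r].
  move=> x01 y01 r01.
  have [|S [SSS /slit_ball[Sx Sy] Sl]] := scale (x, y) r _ r01.
    by split; rewrite /= in_itv.
  have [u1 v1 uv1 _] := uvP S SSS.
  exists S; split => //.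
    have : e * slit_length S <= r.
      move: Sl => /andP[_ Sl]; move: r01 => /andP[r0 _].
      apply: (@le_trans _ _ (e * (K * r))); first by rewrite ler_pM2l.
      by rewrite mulrA ger_pMl.
    by move: Sx; rewrite ltr_distl => /andP[? ?] ?; split; lra.
  by rewrite uv1 -mulrA ler_pM2l//; case/andP: Sl.
have ab01 S : SS S -> 0 <= slit_a S /\ slit_b S <= 1.
  by move=> _; rewrite (ltW (slit_a_gt0 S)) (ltW (slit_b_lt1 S)).
have cX : countable (@slit_x R @` SS).
  exact: sub_countable (card_image_le _ _) cSS.
have [x [x01 xS]] :=
  limsup_layer_thick (mulr_gt0 e0 delta0) delta0 K0 ab01 box cX.
set L := \bigcap_n _ => L0.
have x01' : 0 <= x <= 1 by case/andP: x01 => /ltW -> /ltW ->.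
have gL : [lipschitz F x t | t in `[0, 1]].
  rewrite /lipschitz_on; near=> k => -[s t] [/=]; rewrite !in_itv/= => s01 t01.
  have := vertical_lipschitz x01' xS s01 t01.
  move=> /le_trans; apply.
  rewrite ler_wpM2r//; near: k; exact: nbhs_pinfty_ge.
have := XRNP (F x) gL.
set Q := (fun t => _) => aeQ.
(* A point of [L] lies in arbitrarily short intervals of large defect on the line [x], which
   excludes derivability there. *)
have LQ : L `<=` ~` [set t | Q t].
  move=> t Lt /= Qt.
  have t01 : t \in `]0, 1[.
    have [S [_ _ _]] := Lt 0 Logic.I; rewrite /= !in_itv/= => /andP[? ?].
    have := slit_a_gt0 S; have := slit_b_lt1 S => ? ?.
    by apply/andP; split; lra.
  have c40 : 0 < c / 4 by rewrite divr_gt0.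
  have [d d0 dP] := midpoint_defect_derivable (Qt t01) c40.
  pose n := Num.trunc d^-1.
  have nd : n.+1%:R^-1 < d.
    rewrite -[d]invrK ltf_pV2 ?posrE ?invr_gt0//.
    by have /trunc_itv/andP[] : 0 <= d^-1 by rewrite invr_ge0 ltW.
  have [S [SSS xuv Sn]] := Lt n Logic.I; rewrite /= in_itv/= => tS.
  have [_ _ _ /(_ x xuv xS)] := uvP S SSS.
  rewrite leNgt => /negP; apply; apply: dP => //.
  exact: lt_trans nd.
have mL : measurable L.
  apply: bigcapT_measurable => n; apply: measurable_realfun.open_measurable.
  exact: open_layer.
have : lebesgue_measure L = 0%E.
  by apply: measure_negligible => //; apply: negligibleS aeQ.
by move=> Lz; move: L0; rewrite Lz ltxx.
Unshelve. all: by end_near. Qed.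

End carpet.

(** * Comparison of the sup norm with the Euclidean distance, and conclusion *)

Lemma norm_le_euclidean_dist (R : realType) n (u w : 'rV[R]_n) :
  `|u - w| <= euclidean_dist u w.
Proof.
rewrite [leLHS]/Num.norm/= mx_normrE; apply: bigmax_le; first exact: sqrtr_ge0.
move=> [i j] _ /=; rewrite !mxE ord1 -sqrtr_sqr ler_wsqrtr//.
by rewrite (bigD1 j)//= lerDl sumr_ge0// => k _; exact: sqr_ge0.
Qed.

(** The factor n + 1, rather than the sharp square root of n, is nonzero for n = 0 and can be
    divided by. *)
Lemma euclidean_dist_le_norm (R : realType) n (u w : 'rV[R]_n) :
  euclidean_dist u w <= n.+1%:R * `|u - w|.
Proof.
have coord j : `|u ord0 j - w ord0 j| <= `|u - w|.
  rewrite [leRHS]/Num.norm/= mx_normrE.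
  by apply: le_trans (le_bigmax _ _ (ord0, j)); rewrite !mxE.
rewrite -[leRHS]ger0_norm ?mulr_ge0// -sqrtr_sqr ler_wsqrtr//.
apply: (@le_trans _ _ (\sum_(i < n) `|u - w| ^+ 2)).
  by apply: ler_sum => j _; rewrite -real_normK ?num_real// lerXn2r ?nnegrE.
rewrite sumr_const card_ord -[leLHS]mulr_natl exprMn ler_wpM2r ?sqr_ge0//.
by rewrite -natrX ler_nat (leq_trans (leqnSn n))// -mulnn leq_pmulr.
Qed.

Theorem theorem1p4 (R : realType) (Z : completeMetricType R)
    (hZ : generalized_slit_carpet Z) :
  (forall X : completeNormedModType R, RNP X ->
     ~ exists f : Z -> X, bilipschitz_embedding (@mdist R Z) (@norm_dist R X) f)
  /\
  (forall n : nat, ~ exists f : Z -> 'rV[R]_n,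
     bilipschitz_embedding (@mdist R Z) (@euclidean_dist R n) f).
Proof.
have [SS [gSS [iota [iotaE _]]]] := hZ.
split=> [X XRNP [f [c [C [c0 cC fP]]]]|n [f [c [C [c0 cC fP]]]]].
  (* [RNP X] unfolds to [ae_derivable_lipschitz X]. *)
  exact: (no_bilipschitz c0 cC iotaE fP XRNP gSS).
(* For the sup norm the lower constant drops to c / (n + 1), while the upper constant [C] remains
   valid. *)
have c'0 : 0 < c / n.+1%:R by rewrite divr_gt0.
have c'C : c / n.+1%:R <= C.
  by apply: le_trans cC; rewrite ler_pdivrMr// ler_peMr ?ler1n// ltW.
apply: (no_bilipschitz (f := f) c'0 c'C iotaE _ _ gSS) => [z z'|].
  have /andP[fl fu] := fP z z'; apply/andP; split.
    rewrite mulrAC ler_pdivrMr// [leRHS]mulrC.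
    exact: le_trans fl (euclidean_dist_le_norm _ _).
  exact: le_trans (norm_le_euclidean_dist _ _) fu.
exact: rV_ae_derivable_lipschitz.
Qed.
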